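(* Let $X_0$ be a vector field on $(\mathbb C^2,0)$, quasi-homogeneous of degree $\delta_0$ with respect to a quasi-radial vector field $R$, leaving invariant a curve $S$. Suppose that $X_0$ and $R$ form a basis of the module $\widehat\chi(\log S)$ of formal logarithmic vector fields for $S$. Let $X=X_0+\cdots$ be a perturbation of $X_0$ leaving $S$ invariant. Then, identifications being made through the decomposition of logarithmic fields in the basis $(X_0,R)$: 1. The module of prenormal forms of the foliations defined by $X$ is $$G_K^1=\mathrm{Coker}(X_0)\cdot R .$$ 2. If the degree $\delta_0$ of the initial field $X_0$ is zero, the module of prenormal forms of the vector field $X$ is $$H_K^1=\mathrm{Coker}(X_0)\cdot X_0+\mathrm{Coker}(X_0)\cdot R .$$
   Context: A quasi-radial field is $R=p_1x\partial_x+p_2y\partial_y$ with $p_1,p_2$ relatively prime positive integers; a vector field $X_0$ is quasi-homogeneous of degree $\delta_0$ if $[R,X_0]=\delta_0X_0$. $\widehat{\mathcal O}_2=\mathbb C[[x,y]]$. $S$ is a germ of curve at $0\in\mathbb C^2$ with reduced equation $h_0=0$; $\widehat\chi(\log S)$ is the $\widehat{\mathcal O}_2$-module of formal vector fields $X$ with $X(h_0)\in(h_0)$. $X=X_0+\cdots$ is an element of $\widehat\chi(\log S)$ such that all quasi-homogeneous components of $X-X_0$ have degree $>\delta_0$. Put $B_K^1=\{[X_0,Z]:Z\in\widehat\chi(\log S)\}$ and $A_K^1=B_K^1+\widehat{\mathcal O}_2X_0$. The module of prenormal forms of vector fields is the quotient $H_K^1=\widehat\chi(\log S)/B_K^1$,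 and the module of prenormal forms of foliations is $G_K^1=\widehat\chi(\log S)/A_K^1$; they are modules over the ring of formal first integrals of $X_0$. $\mathrm{Coker}(X_0)=\widehat{\mathcal O}_2/X_0(\widehat{\mathcal O}_2)$ is the cokernel of $X_0$ acting as a derivation on $\widehat{\mathcal O}_2$, also a module over this ring. Equalities are isomorphisms of modules over this ring, where $\mathrm{Coker}(X_0)\cdot R$ (resp. $\mathrm{Coker}(X_0)\cdot X_0$) denotes a copy of $\mathrm{Coker}(X_0)$ recording the class of the coefficient $\beta$ (resp. $\alpha$) of a field $\alpha X_0+\beta R$, and the sum in 2 is direct. *)

(* Defs.v *)
From HB Require Import structures.
From mathcomp Require Import all_boot all_order all_algebra.
From mathcomp Require Import ring_quotient.
From mathcomp Require Import boolp.
From mathcomp Require Export complex.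
From mathcomp Require Export reals.

Set Implicit Arguments.
Unset Strict Implicit.
Unset Printing Implicit Defensive.

Import Order.TTheory GRing.Theory Num.Theory.
Local Open Scope ring_scope.

(* C[[x, y]]: the series f stands for \sum_(i, j) f i j x^i y^j. *)
Definition fps2 (C : Type) := nat -> nat -> C.

HB.instance Definition _ (C : choiceType) :=
  Choice.copy (fps2 C) (nat -> nat -> C).

(* The ring operations are locked so that unification does not unfold them. *)
HB.lock Definition fps_zero (C : zmodType) : fps2 C := fun _ _ => 0.
HB.lock Definition fps_opp (C : zmodType) (f : fps2 C) : fps2 C :=
  fun i j => - f i j.
HB.lock Definition fps_add (C : zmodType) (f g : fps2 C) : fps2 C :=
  fun i j => f i j + g i j.
HB.lock Definition fps_one (C : comNzRingType) : fps2 C :=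
  fun i j => ((i == 0%N) && (j == 0%N))%:R.
HB.lock Definition fps_mul (C : comNzRingType) (f g : fps2 C) : fps2 C :=
  fun i j =>
    \sum_(a < i.+1) \sum_(b < j.+1) f a b * g (i - a)%N (j - b)%N.

Section FpsZmodule.
Variable C : zmodType.
Implicit Types f g h : fps2 C.

Lemma fpsP f g : (forall i j, f i j = g i j) -> f = g.
Proof. by move=> fg; apply: funext => i; apply: funext. Qed.

Lemma fps_addA : associative (@fps_add C).
Proof. by move=> f g h; apply: fpsP => i j; rewrite unlock addrA. Qed.
Lemma fps_addC : commutative (@fps_add C).
Proof. by move=> f g; apply: fpsP => i j; rewrite unlock addrC. Qed.
Lemma fps_add0 : left_id (fps_zero C) (@fps_add C).
Proof. by move=> f; apply: fpsP => i j; rewrite !unlock add0r. Qed.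
Lemma fps_addN : left_inverse (fps_zero C) (@fps_opp C) (@fps_add C).
Proof. by move=> f; apply: fpsP => i j; rewrite !unlock addNr. Qed.

HB.instance Definition _ :=
  GRing.isZmodule.Build (fps2 C) fps_addA fps_addC fps_add0 fps_addN.

Lemma fps0E i j : (0 : fps2 C) i j = 0.
Proof. by rewrite /GRing.zero /= unlock. Qed.
Lemma fpsDE f g i j : (f + g) i j = f i j + g i j.
Proof. by rewrite (_ : f + g = fps_add f g) // unlock. Qed.
Lemma fpsNE f i j : (- f) i j = - f i j.
Proof. by rewrite (_ : - f = fps_opp f) // unlock. Qed.
Lemma fpsMnE f n i j : (f *+ n) i j = f i j *+ n.
Proof. by elim: n => [|n IHn]; rewrite ?mulr0n ?fps0E // !mulrS fpsDE IHn. Qed.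

End FpsZmodule.

Section FpsRing.
Variable C : comNzRingType.
Implicit Types f g h : fps2 C.

Let mulE f g i j : fps_mul f g i j =
  \sum_(a < i.+1) \sum_(b < j.+1) f a b * g (i - a)%N (j - b)%N.
Proof. by rewrite unlock. Qed.

(* Ring identities are transferred from {poly {poly C}} by truncation. *)
Let trunc n f : {poly {poly C}} := \poly_(i < n) \poly_(j < n) f i j.

Let truncE n f i j : (i < n)%N -> (j < n)%N -> (trunc n f)`_i`_j = f i j.
Proof. by move=> lti ltj; rewrite !coef_poly lti coef_poly ltj. Qed.

Let agree n (p q : {poly {poly C}}) :=
  forall i j, (i < n)%N -> (j < n)%N -> p`_i`_j = q`_i`_j.

Let agreeM n p p' q q' :
  agree n p p' -> agree n q q' -> agree n (p * q) (p' * q').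
Proof.
move=> epp eqq i j lti ltj; rewrite !coefM !coef_sum; apply: eq_bigr => a _.
rewrite !coefM; apply: eq_bigr => b _.
have ltE k (c : 'I_k.+1) : (k < n)%N -> (c < n)%N /\ (k - c < n)%N.
  move=> ltk; split; first exact: leq_ltn_trans (ltn_ord c : c <= k)%N ltk.
  exact: leq_ltn_trans (leq_subr _ _) ltk.
have [ai ia] := ltE _ a lti; have [bj jb] := ltE _ b ltj.
by rewrite epp ?eqq.
Qed.

Let truncM n f g : agree n (trunc n (fps_mul f g)) (trunc n f * trunc n g).
Proof.
move=> i j lti ltj; rewrite truncE // mulE coefM coef_sum.
apply: eq_bigr => a _; rewrite coefM; apply: eq_bigr => b _.
have ltE k (c : 'I_k.+1) : (k < n)%N -> (c < n)%N /\ (k - c < n)%N.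
  move=> ltk; split; first exact: leq_ltn_trans (ltn_ord c : c <= k)%N ltk.
  exact: leq_ltn_trans (leq_subr _ _) ltk.
have [ai ia] := ltE _ a lti; have [bj jb] := ltE _ b ltj.
by rewrite !truncE.
Qed.

Let agree_fps f g :
  (forall n, agree n (trunc n f) (trunc n g)) -> f = g.
Proof.
move=> fg; apply: fpsP => i j; pose n := (i + j).+1.
have lti : (i < n)%N by rewrite ltnS leq_addr.
have ltj : (j < n)%N by rewrite ltnS leq_addl.
by rewrite -(truncE f lti ltj) fg ?truncE.
Qed.

Lemma fps_mulA : associative (@fps_mul C).
Proof.
move=> f g h; apply: agree_fps => n i j lti ltj.
rewrite !truncM //.
rewrite (agreeM (q' := trunc n g * trunc n h) (fun _ _ _ _ => erefl)
  (@truncM n g h)) //.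
by rewrite mulrA; apply/esym/agreeM => //; apply: truncM.
Qed.

Lemma fps_mulC : commutative (@fps_mul C).
Proof.
by move=> f g; apply: agree_fps => n i j lti ltj; rewrite !truncM // mulrC.
Qed.

Lemma fps_mul1 : left_id (fps_one C) (@fps_mul C).
Proof.
move=> f; apply: fpsP => i j; rewrite mulE fps_one.unlock.
rewrite big_ord_recl big_ord_recl /=.
rewrite mul1r !subn0 !big1 ?addr0 // => [a _|b _].
  by apply: big1 => b _; rewrite mul0r.
by rewrite mul0r.
Qed.

Lemma fps_mulDl : left_distributive (@fps_mul C) +%R.
Proof.
move=> f g h; apply: fpsP => i j; rewrite fpsDE !mulE -big_split.
apply: eq_bigr => a _; rewrite -big_split; apply: eq_bigr => b _.
by rewrite fpsDE mulrDl.
Qed.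

Lemma fps_one_neq0 : fps_one C != 0.
Proof.
apply/eqP => /(congr1 (fun f : fps2 C => f 0%N 0%N)) /eqP.
by rewrite unlock fps0E oner_eq0.
Qed.

HB.instance Definition _ := GRing.Zmodule_isComNzRing.Build (fps2 C)
  fps_mulA fps_mulC fps_mul1 fps_mulDl fps_one_neq0.

Lemma fps1E i j : (1 : fps2 C) i j = ((i == 0%N) && (j == 0%N))%:R.
Proof. by rewrite (_ : 1 = fps_one C) // unlock. Qed.

Lemma fpsME f g i j : (f * g) i j =
  \sum_(a < i.+1) \sum_(b < j.+1) f a b * g (i - a)%N (j - b)%N.
Proof. exact: mulE. Qed.

(* Partial derivatives with respect to x and y. *)
Definition dx f : fps2 C := fun i j => f i.+1 j *+ i.+1.
Definition dy f : fps2 C := fun i j => f i j.+1 *+ j.+1.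

Definition fps_x : fps2 C := fun i j => ((i == 1%N) && (j == 0%N))%:R.
Definition fps_y : fps2 C := fun i j => ((i == 0%N) && (j == 1%N))%:R.

Lemma dxD f g : dx (f + g) = dx f + dx g.
Proof. by apply: fpsP => i j; rewrite /dx !fpsDE mulrnDl. Qed.
Lemma dyD f g : dy (f + g) = dy f + dy g.
Proof. by apply: fpsP => i j; rewrite /dy !fpsDE mulrnDl. Qed.
Lemma dxN f : dx (- f) = - dx f.
Proof. by apply: fpsP => i j; rewrite /dx !fpsNE mulNrn. Qed.
Lemma dyN f : dy (- f) = - dy f.
Proof. by apply: fpsP => i j; rewrite /dy !fpsNE mulNrn. Qed.

Lemma dxM f g : dx (f * g) = dx f * g + f * dx g.
Proof.
apply: fpsP => i j; pose m := (i + j).+1; pose n := m.+1.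
have lti : (i < m)%N by rewrite ltnS leq_addr.
have ltj : (j < m)%N by rewrite ltnS leq_addl.
have agr h : agree m (trunc n h) (trunc m h).
  by move=> a b lta ltb; rewrite !truncE // ltnW.
have agrd h : agree m (trunc n h)^`() (trunc m (dx h)).
  move=> a b lta ltb; rewrite coef_deriv coefMn !truncE ?ltnS //.
  exact: ltnW.
have -> : dx (f * g) i j = (trunc n f * trunc n g)^`()`_i`_j.
  rewrite coef_deriv coefMn -truncM //; last exact: ltnW.
  by rewrite truncE // ltnW.
rewrite derivM !coefD fpsDE -(truncE (dx f * g) lti ltj).
rewrite -(truncE (f * dx g) lti ltj) !truncM //.
by congr (_ + _); apply: agreeM.
Qed.

Let swap f : fps2 C := fun i j => f j i.

Let swapM f g : swap (f * g) = swap f * swap g.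
Proof. by apply: fpsP => i j; rewrite /swap !fpsME exchange_big. Qed.

Let swapD f g : swap (f + g) = swap f + swap g.
Proof. by apply: fpsP => i j; rewrite /swap !fpsDE. Qed.

Lemma dyM f g : dy (f * g) = dy f * g + f * dy g.
Proof.
have dyE h : dy h = swap (dx (swap h)) by [].
by rewrite dyE swapM dxM swapD !swapM.
Qed.

Lemma dx_dy f : dx (dy f) = dy (dx f).
Proof. by apply: fpsP => i j; rewrite /dx /dy -!mulrnA mulnC. Qed.

End FpsRing.

(* A vector field X.1 d/dx + X.2 d/dy, as an element of the free
   C[[x, y]]-module of rank two. *)
Definition vfield (C : comNzRingType) : Type := ((fps2 C)^o * (fps2 C)^o)%type.

HB.instance Definition _ (C : comNzRingType) :=
  GRing.Lmodule.copy (vfield C) ((fps2 C)^o * (fps2 C)^o)%type.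

Section VectorFields.
Variable C : comNzRingType.
Implicit Types (X Y Z : vfield C) (f g : fps2 C).

Definition vapp X f : fps2 C := X.1 * dx f + X.2 * dy f.

Definition bracket X Y : vfield C :=
  (vapp X Y.1 - vapp Y X.1, vapp X Y.2 - vapp Y X.2).

Definition radial (p1 p2 : nat) : vfield C :=
  (fps_x C *+ p1, fps_y C *+ p2).

Definition quasi_homogeneous (p1 p2 : nat) (d : int) X :=
  bracket (radial p1 p2) X = X *~ d.

(* Component of weighted degree d, where x^i y^j has degree p1 i + p2 j,
   and the monomial field x^i y^j d/dx has degree p1 i + p2 j - p1. *)
Definition fps_component (p1 p2 : nat) (d : int) f : fps2 C :=
  fun i j => if (p1 * i + p2 * j)%N%:Z == d then f i j else 0.

Definition vcomponent (p1 p2 : nat) (d : int) X : vfield C :=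
  (fps_component p1 p2 (d + p1%:Z) X.1, fps_component p1 p2 (d + p2%:Z) X.2).

Lemma vappD X f g : vapp X (f + g) = vapp X f + vapp X g.
Proof. by rewrite /vapp dxD dyD !mulrDr addrACA. Qed.
Lemma vappN X f : vapp X (- f) = - vapp X f.
Proof. by rewrite /vapp dxN dyN !mulrN opprD. Qed.
Lemma vappB X f g : vapp X (f - g) = vapp X f - vapp X g.
Proof. by rewrite vappD vappN. Qed.
Lemma vapp0 X : vapp X 0 = 0.
Proof. by rewrite -[in LHS](subrr 0) vappB subrr. Qed.
Lemma vappM X f g : vapp X (f * g) = vapp X f * g + f * vapp X g.
Proof.
rewrite /vapp dxM dyM !mulrDr mulrDl !mulrA (mulrC f X.1) (mulrC f X.2).
by rewrite addrACA.
Qed.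
Lemma vapp1 X : vapp X 1 = 0.
Proof.
have h := vappM X 1 1; rewrite !mulr1 mul1r in h.
by apply: (addIr (vapp X 1)); rewrite add0r -h.
Qed.
Lemma vappDl X Y f : vapp (X + Y) f = vapp X f + vapp Y f.
Proof. by rewrite /vapp !mulrDl addrACA. Qed.
Lemma vappNl X f : vapp (- X) f = - vapp X f.
Proof. by rewrite /vapp !mulNr opprD. Qed.
Lemma vappZl g X f : vapp (g *: X) f = g * vapp X f.
Proof. by rewrite /vapp mulrDr !mulrA. Qed.

Lemma vfieldP X Y : X.1 = Y.1 -> X.2 = Y.2 -> X = Y.
Proof. by case: X Y => [? ?] [? ?] /= -> ->. Qed.

Lemma bracketB X Y Z : bracket X (Y - Z) = bracket X Y - bracket X Z.
Proof.
have E f g a : vapp X (f - g) - vapp (Y - Z) a =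
    (vapp X f - vapp Y a) - (vapp X g - vapp Z a).
  by rewrite vappB vappDl vappNl !opprD addrACA.
by apply: vfieldP; apply: E.
Qed.
Lemma bracketZ X f Y : bracket X (f *: Y) = vapp X f *: Y + f *: bracket X Y.
Proof.
have E g a : vapp X (f * g) - vapp (f *: Y) a =
    vapp X f * g + f * (vapp X g - vapp Y a).
  by rewrite vappM vappZl mulrBr addrA.
by apply: vfieldP; apply: E.
Qed.

End VectorFields.

Section FirstIntegrals.
Variables (C : comNzRingType) (X0 : vfield C).

Definition first_integral_pred : {pred fps2 C} :=
  fun f => `[< vapp X0 f = 0 >].

Lemma first_integral_subring : subring_closed first_integral_pred.
Proof.
split=> [|f g /asboolP Xf /asboolP Xg|f g /asboolP Xf /asboolP Xg];
  apply/asboolP.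
- exact: vapp1.
- by rewrite vappB Xf Xg subr0.
- by rewrite vappM Xf Xg mul0r mulr0 addr0.
Qed.

HB.instance Definition _ :=
  GRing.isSubringClosed.Build (fps2 C) first_integral_pred
    first_integral_subring.

(* The ring of formal first integrals of X0. *)
Record first_integral := FirstIntegral {
  first_integral_val : fps2 C;
  _ : first_integral_val \in first_integral_pred
}.

HB.instance Definition _ := [isSub for first_integral_val].
HB.instance Definition _ := [Choice of first_integral by <:].
HB.instance Definition _ := [SubChoice_isSubComNzRing of first_integral by <:].

End FirstIntegrals.

(* Restriction of scalars from C[[x, y]] to the first integrals of X0. *)
Definition restrict_scalars (C : comNzRingType) (X0 : vfield C)
  (V : lmodType (fps2 C)) : Type := V.

Section Restrict.
Variables (C : comNzRingType) (X0 : vfield C) (V : lmodType (fps2 C)).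
Local Notation K := (first_integral X0).
Local Notation W := (restrict_scalars X0 V).

HB.instance Definition _ := GRing.Zmodule.copy W V.

Definition restrict_scale (f : K) (v : W) : W :=
  val f *: (v : V).

Lemma restrict_scaleA f g v :
  restrict_scale f (restrict_scale g v) = restrict_scale (f * g) v.
Proof. by rewrite /restrict_scale scalerA. Qed.
Lemma restrict_scale1 : left_id 1 restrict_scale.
Proof. by move=> v; rewrite /restrict_scale scale1r. Qed.
Lemma restrict_scaleDr : right_distributive restrict_scale +%R.
Proof. by move=> f v w; apply: scalerDr. Qed.
Lemma restrict_scaleDl v : {morph restrict_scale^~ v : f g / f + g}.
Proof. by move=> f g; apply: scalerDl. Qed.

HB.instance Definition _ := GRing.Zmodule_isLmodule.Build K
  W restrict_scaleA restrict_scale1 restrict_scaleDr restrict_scaleDl.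

End Restrict.

Section QuotientModule.
Variables (K : nzRingType) (V : lmodType K) (S : submodClosed V).

(* submodClosed does not carry closure under opposite, which holds here
   because the scalars form a ring. *)
Definition submod_pred : {pred V} := S.

Lemma submod_pred_zmod : zmod_closed submod_pred.
Proof.
split=> [|v w Sv Sw]; first exact: (rpred0 S).
by rewrite -scaleN1r; apply: (rpredD (S := S)) => //; apply: (rpredZ (s := S)).
Qed.

HB.instance Definition _ :=
  GRing.isZmodClosed.Build V submod_pred submod_pred_zmod.

Definition quotmod : Type := Quotient.quot submod_pred.

HB.instance Definition _ := GRing.Zmodule.on quotmod.

Definition qclass (v : V) : quotmod := \pi_(Quotient.quot submod_pred)%qT v.

Lemma qclassP v w : qclass v = qclass w <-> v - w \in S.
Proof.
rewrite /qclass; split=> [/eqP|h]; first by rewrite -Quotient.idealrBE.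
by apply/eqP; rewrite -Quotient.idealrBE.
Qed.

Lemma qclassD v w : qclass (v + w) = qclass v + qclass w.
Proof. exact: raddfD. Qed.

Lemma qclass_surj (q : quotmod) : exists v, q = qclass v.
Proof. by exists (repr q); rewrite /qclass reprK. Qed.

Definition quotmod_scale (a : K) (q : quotmod) : quotmod :=
  qclass (a *: repr q).

Lemma qclassZ a v : quotmod_scale a (qclass v) = qclass (a *: v).
Proof.
apply/qclassP; rewrite -scalerBr rpredZ //.
by apply/qclassP; rewrite /qclass reprK.
Qed.

Lemma quotmod_scaleA a b q :
  quotmod_scale a (quotmod_scale b q) = quotmod_scale (a * b) q.
Proof. by have [v ->] := qclass_surj q; rewrite !qclassZ scalerA. Qed.
Lemma quotmod_scale1 : left_id 1 quotmod_scale.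
Proof. by move=> q; have [v ->] := qclass_surj q; rewrite qclassZ scale1r. Qed.
Lemma quotmod_scaleDr : right_distributive quotmod_scale +%R.
Proof.
move=> a q r; have [v ->] := qclass_surj q; have [w ->] := qclass_surj r.
by rewrite -qclassD !qclassZ -qclassD scalerDr.
Qed.
Lemma quotmod_scaleDl q : {morph quotmod_scale^~ q : a b / a + b}.
Proof.
by move=> a b; have [v ->] := qclass_surj q; rewrite !qclassZ -qclassD scalerDl.
Qed.

HB.instance Definition _ := GRing.Zmodule_isLmodule.Build K quotmod
  quotmod_scaleA quotmod_scale1 quotmod_scaleDr quotmod_scaleDl.

Lemma qclass_linear : linear qclass.
Proof. by move=> a v w; rewrite qclassD -qclassZ. Qed.

HB.instance Definition _ :=
  GRing.isLinear.Build K V quotmod _ qclass qclass_linear.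

End QuotientModule.

Section Cokernel.
Variables (C : comNzRingType) (X0 : vfield C).

Definition vimage_pred : {pred restrict_scalars X0 (fps2 C)^o} :=
  fun f => `[< exists g : fps2 C, f = vapp X0 g >].

Lemma vimage_submod : subsemimod_closed vimage_pred.
Proof.
apply: GRing.submod_closed_semi; split.
  by apply/asboolP; exists 0; rewrite vapp0.
move=> a f1 f2 /asboolP[g1 ->] /asboolP[g2 ->]; apply/asboolP.
exists (val a * g1 + g2); rewrite vappD vappM.
by have /asboolP -> := valP a; rewrite mul0r add0r.
Qed.

HB.instance Definition _ := GRing.isSubmodClosed.Build _ _
  vimage_pred vimage_submod.

Definition Coker := quotmod vimage_pred.
HB.instance Definition _ := GRing.Lmodule.on Coker.

Definition coker_class (f : fps2 C) : Coker :=
  qclass vimage_pred (f : restrict_scalars X0 (fps2 C)^o).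

End Cokernel.

Section Logarithmic.
Variables (C : comNzRingType) (h0 : fps2 C).

Definition log_pred : {pred vfield C} :=
  fun X => `[< exists k : fps2 C, vapp X h0 = k * h0 >].

Lemma log_submod : subsemimod_closed log_pred.
Proof.
apply: GRing.submod_closed_semi; split.
  by apply/asboolP; exists 0; rewrite /vapp !mul0r addr0.
move=> a X Y /asboolP[k Xk] /asboolP[l Yl]; apply/asboolP; exists (a * k + l).
by rewrite vappDl vappZl Xk Yl mulrDl mulrA.
Qed.

HB.instance Definition _ := GRing.isSubmodClosed.Build _ _ log_pred log_submod.

(* The C[[x, y]]-module of formal logarithmic vector fields along h0 = 0. *)
Record log_field := LogField {
  log_field_val : vfield C;
  _ : log_field_val \in log_pred
}.

HB.instance Definition _ := [isSub for log_field_val].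
HB.instance Definition _ := [Choice of log_field by <:].
HB.instance Definition _ := [SubChoice_isSubLmodule of log_field by <:].

(* X and Y form a basis of this module. *)
Definition log_basis (X Y : vfield C) : Prop :=
  [/\ X \in log_pred, Y \in log_pred &
      forall Z, Z \in log_pred ->
        exists! ab : fps2 C * fps2 C, Z = ab.1 *: X + ab.2 *: Y].

End Logarithmic.

Section PrenormalForms.
Variables (C : comNzRingType) (h0 : fps2 C) (X0 : vfield C).

Definition B1K_pred : {pred restrict_scalars X0 (log_field h0)} :=
  fun W => `[< exists Z : log_field h0,
                 val (W : log_field h0) = bracket X0 (val Z) >].

Definition A1K_pred : {pred restrict_scalars X0 (log_field h0)} :=
  fun W => `[< exists Z : log_field h0, exists g : fps2 C,
                 val (W : log_field h0) = bracket X0 (val Z) + g *: X0 >].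

Lemma bracketr0 : bracket X0 0 = 0.
Proof. by rewrite -[in LHS](subrr X0) bracketB subrr. Qed.

Lemma bracket_lin (a : first_integral X0) (Y Z : vfield C) :
  bracket X0 (val a *: Y + Z) = val a *: bracket X0 Y + bracket X0 Z.
Proof.
have aX : vapp X0 (val a) = 0 by have /asboolP := valP a.
have bD Y' : bracket X0 (Y' + Z) = bracket X0 Y' + bracket X0 Z.
  rewrite -[Z in LHS]opprK bracketB -[- Z]add0r bracketB bracketr0.
  by rewrite sub0r opprK.
by rewrite bD bracketZ aX scale0r add0r.
Qed.

Lemma B1K_submod : subsemimod_closed B1K_pred.
Proof.
apply: GRing.submod_closed_semi; split.
  by apply/asboolP; exists 0; apply/esym; apply: bracketr0.
move=> a V W /asboolP[Y eV] /asboolP[Z eW]; apply/asboolP.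
exists (val a *: Y + Z).
by rewrite [RHS]bracket_lin -eV -eW.
Qed.

Lemma A1K_submod : subsemimod_closed A1K_pred.
Proof.
apply: GRing.submod_closed_semi; split.
  by apply/asboolP; exists 0, 0; rewrite scale0r addr0; apply/esym/bracketr0.
move=> a V W /asboolP[Y [f eV]] /asboolP[Z [g eW]]; apply/asboolP.
exists (val a *: Y + Z), (val a * f + g).
rewrite [bracket X0 _]bracket_lin scalerDl -scalerA addrACA -scalerDr -eV -eW.
by [].
Qed.

HB.instance Definition _ := GRing.isSubmodClosed.Build _ _ B1K_pred B1K_submod.
HB.instance Definition _ := GRing.isSubmodClosed.Build _ _ A1K_pred A1K_submod.

(* Modules of prenormal forms of vector fields and of foliations for the
   perturbations X = X0 + ...; they depend on X only through X0. *)
Definition H1K := quotmod B1K_pred.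
Definition G1K := quotmod A1K_pred.
HB.instance Definition _ := GRing.Lmodule.on H1K.
HB.instance Definition _ := GRing.Lmodule.on G1K.

Definition H1K_class (Z : log_field h0) : H1K :=
  qclass B1K_pred (Z : restrict_scalars X0 (log_field h0)).
Definition G1K_class (Z : log_field h0) : G1K :=
  qclass A1K_pred (Z : restrict_scalars X0 (log_field h0)).

End PrenormalForms.

Section Germs.
Variable C : numDomainType.
Implicit Types f g h : fps2 C.

(* f converges near 0, by Cauchy's estimates. *)
Definition convergent f := exists M r : C,
  0 < r /\ forall i j, `|f i j| * r ^+ (i + j) <= M.

Definition vconvergent (X : vfield C) := convergent X.1 /\ convergent X.2.

Definition germ_dvd h f := exists2 k, convergent k & f = k * h.

(* h = 0 is a reduced equation of a germ of curve at 0: the ideal (h) of C{x, y}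
   is proper, nonzero and radical. *)
Definition reduced_equation h := [/\ convergent h, h != 0, h 0%N 0%N = 0 &
  forall f n, convergent f -> germ_dvd h (f ^+ n) -> germ_dvd h f].

End Germs.

(* Main.v *)
From HB Require Import structures.
Require Import Defs.
From mathcomp Require Import all_boot all_order all_algebra.
From mathcomp Require Import complex reals.
From mathcomp Require Import boolp.
Import GRing.Theory Num.Theory.
Local Open Scope ring_scope.

Set Implicit Arguments.
Unset Strict Implicit.
Unset Printing Implicit Defensive.

(** Write [R] for the radial field, so that [[X0, R] = - delta0 X0].  Then
[[X0, alpha X0 + beta R] = (X0(alpha) - delta0 beta) X0 + X0(beta) R].
Modulo the multiples of [X0] only the coefficient [X0(beta)] remains, and for
[delta0 = 0] the bracket acts as [X0] on both coefficients. *)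

(** First isomorphism theorem. Linearity of [f] is a separate hypothesis, so that a bare coordinate
    function can be supplied. *)
Lemma quotmod_iso (K : nzRingType) (V W : lmodType K) (S : submodClosed V)
    (f : V -> W) (f_lin : linear f) (f_surj : forall w, exists v, f v = w)
    (f_ker : forall v, f v = 0 <-> v \in S) :
  exists phi : {linear quotmod S -> W},
    bijective phi /\ forall v, phi (qclass S v) = f v.
Proof.
pose F : {linear V -> W} := HB.pack f (GRing.isLinear.Build K V W *:%R f f_lin).
have Feq v w : qclass S v = qclass S w <-> F v = F w.
  have fB : f (v - w) = F v - F w := raddfB F v w.
  rewrite qclassP -f_ker fB; split=> [/eqP|->]; last exact: subrr.
  by rewrite subr_eq0 => /eqP.
(* The induced map is read off the canonical representative; by [Feq] any other representative gives
   the same value. *)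
pose g (q : quotmod S) : W := F (repr q).
have gE v : g (qclass S v) = F v by apply/Feq; rewrite /qclass reprK.
have g_lin : linear g.
  move=> a q r; have [v ->] := qclass_surj q; have [w ->] := qclass_surj r.
  by rewrite -linearP !gE linearP.
pose G : {linear quotmod S -> W} :=
  HB.pack g (GRing.isLinear.Build K (quotmod S) W *:%R g g_lin).
exists G; split=> [|v]; last exact: gE.
(* The inverse takes the class of a chosen preimage; [Feq] makes this class independent of the
   choice. *)
pose h w := qclass S (projT1 (cid (f_surj w))).
have fh w : F (projT1 (cid (f_surj w))) = w by case: cid.
exists h => [q|w]; last by rewrite -[G _]/(g _) gE fh.
by have [v ->] := qclass_surj q; apply/Feq; rewrite fh -[G _]/(g _) gE.
Qed.

Section LogarithmicBasis.
Variables (C : comNzRingType) (h0 : fps2 C) (X Y : vfield C).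
Hypothesis XY_basis : log_basis h0 X Y.
Implicit Types (Z : log_field h0) (a b : fps2 C).

Lemma log_basis_coord Z :
  exists! ab : fps2 C * fps2 C, val Z = ab.1 *: X + ab.2 *: Y.
Proof. by case: XY_basis => _ _; apply; apply: valP. Qed.

(** Description turns the unique existence of coefficients into a function; existence yields
    [log_coordE], uniqueness [log_coord_eq]. *)
Definition log_coord Z : fps2 C * fps2 C := projT1 (cid (log_basis_coord Z)).

Lemma log_coordE Z : val Z = (log_coord Z).1 *: X + (log_coord Z).2 *: Y.
Proof. by rewrite /log_coord; case: cid => ab []. Qed.

Lemma log_coord_eq Z a b : val Z = a *: X + b *: Y -> log_coord Z = (a, b).
Proof. by rewrite /log_coord; case: cid => ab /= [_ +] Zab; apply. Qed.

Lemma log_basis_mem a b : a *: X + b *: Y \in log_pred h0.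
Proof.
by case: XY_basis => logX logY _; apply: rpredD; apply: rpredZ.
Qed.

Definition log_comb a b : log_field h0 := LogField (log_basis_mem a b).

Lemma log_combK a b : log_coord (log_comb a b) = (a, b).
Proof. exact: log_coord_eq. Qed.

Lemma log_coordZD f Z1 Z2 : log_coord (f *: Z1 + Z2) =
  (f * (log_coord Z1).1 + (log_coord Z2).1,
   f * (log_coord Z1).2 + (log_coord Z2).2).
Proof.
apply: log_coord_eq; rewrite linearP /= !log_coordE.
by rewrite scalerDr !scalerA addrACA -!scalerDl.
Qed.

End LogarithmicBasis.

Lemma bracketC (C : comNzRingType) (X Y : vfield C) :
  bracket X Y = - bracket Y X.
Proof. by apply: vfieldP; rewrite /= opprB. Qed.

Lemma bracketD (C : comNzRingType) (X Y Z : vfield C) :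
  bracket X (Y + Z) = bracket X Y + bracket X Z.
Proof.
by rewrite -[Z in LHS]opprK bracketB -[- Z]sub0r bracketB bracketr0 sub0r opprK.
Qed.

Lemma bracketxx (C : comNzRingType) (X : vfield C) : bracket X X = 0.
Proof. by apply: vfieldP; rewrite /= subrr. Qed.

Section PrenormalForms.
Variables (C : comNzRingType) (h0 : fps2 C) (X0 R : vfield C) (d : int).
Hypothesis R_X0 : bracket R X0 = X0 *~ d.
Hypothesis X0_R_basis : log_basis h0 X0 R.
Local Notation coord := (@log_coord C h0 X0 R X0_R_basis).
Local Notation comb := (@log_comb C h0 X0 R X0_R_basis).
Local Notation V := (restrict_scalars X0 (log_field h0)).
Implicit Types (Z W : log_field h0) (a b : fps2 C).

Lemma bracket_comb a b : bracket X0 (a *: X0 + b *: R) =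
  (vapp X0 a - b *~ d) *: X0 + vapp X0 b *: R.
Proof.
rewrite bracketD !bracketZ bracketxx scaler0 addr0 (bracketC X0 R) R_X0.
by rewrite scalerN -scalerMzr scalerMzl scalerBl addrA addrAC.
Qed.

(** The free term [g *: X0] absorbs whatever the bracket puts on [X0], so only the coefficient of
    [R] is constrained. *)
Lemma A1K_coord W :
  (W : V) \in @A1K_pred C h0 X0 <-> exists b, (coord W).2 = vapp X0 b.
Proof.
split=> [/asboolP[Z [g eW]]|[b Wb]].
  exists (coord Z).2; move: eW.
  rewrite (log_coordE X0_R_basis Z) bracket_comb addrAC -scalerDl.
  by move/(log_coord_eq X0_R_basis) ->.
(* The bracket with [b *: R] produces [- (b *~ d)] on [X0]; the summand [b *~ d] cancels it. *)
apply/asboolP; exists (comb 0 b), ((coord W).1 + b *~ d).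
rewrite bracket_comb vapp0 sub0r addrAC -scalerDl addrCA addNr addr0 -Wb.
exact: log_coordE.
Qed.

(** For [d = 0] the term [b *~ d] coupling the two coefficients vanishes, so the two equations are
    solved independently. *)
Lemma B1K_coord W : d = 0 ->
  (W : V) \in @B1K_pred C h0 X0 <->
  (exists a, (coord W).1 = vapp X0 a) /\ (exists b, (coord W).2 = vapp X0 b).
Proof.
move=> d0.
split=> [/asboolP[Z eW]|[[a Wa] [b Wb]]].
  move: eW; rewrite (log_coordE X0_R_basis Z) bracket_comb d0 mulr0z subr0.
  move/(log_coord_eq X0_R_basis) ->.
  by split; [exists (coord Z).1 | exists (coord Z).2].
apply/asboolP; exists (comb a b).
by rewrite bracket_comb d0 mulr0z subr0 -Wa -Wb; apply: log_coordE.
Qed.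

Lemma coker_class_eq0 a : coker_class X0 a = 0 <-> exists b, a = vapp X0 b.
Proof.
rewrite /coker_class -(linear0 (qclass (@vimage_pred C X0))) qclassP subr0.
by split=> [/asboolP|] // h; apply/asboolP.
Qed.

Lemma coker_class_linear (f : first_integral X0) a b :
  coker_class X0 (val f * a + b) = f *: coker_class X0 a + coker_class X0 b.
Proof. exact: (qclass_linear (@vimage_pred C X0)). Qed.

Lemma G1K_iso : exists phi : {linear G1K h0 X0 -> Coker X0},
  bijective phi /\
  forall a b Z, val Z = a *: X0 + b *: R ->
    phi (G1K_class X0 Z) = coker_class X0 b.
Proof.
have [||v|phi [phi_bij phiE]] := @quotmod_iso _ V (Coker X0)
  (@A1K_pred C h0 X0) (fun Z => coker_class X0 (coord Z).2).
(* A first integral acts on [V] through its underlying series [val f]. *)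
- by move=> f Z W /=; rewrite (log_coordZD X0_R_basis (val f)) coker_class_linear.
- move=> w; have [b ->] := qclass_surj w.
  by exists (comb 0 b); rewrite log_combK.
- by rewrite coker_class_eq0 A1K_coord.
(* By uniqueness, any decomposition of [Z] is the one used to build [phi]. *)
exists phi; split=> // a b Z /(log_coord_eq X0_R_basis) Zab.
by rewrite /G1K_class phiE Zab.
Qed.

Lemma H1K_iso : d = 0 ->
  exists phi : {linear H1K h0 X0 -> (Coker X0 * Coker X0)%type},
  bijective phi /\
  forall a b Z, val Z = a *: X0 + b *: R ->
    phi (H1K_class X0 Z) = (coker_class X0 a, coker_class X0 b).
Proof.
move=> d0.
have [||v|phi [phi_bij phiE]] := @quotmod_iso _ V (Coker X0 * Coker X0)%type
  (@B1K_pred C h0 X0)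
  (fun Z => (coker_class X0 (coord Z).1, coker_class X0 (coord Z).2)).
- by move=> f Z W /=; rewrite (log_coordZD X0_R_basis (val f)) !coker_class_linear.
- move=> [w1 w2]; have [a ->] := qclass_surj w1; have [b ->] := qclass_surj w2.
  by exists (comb a b); rewrite log_combK.
(* A pair of classes is zero exactly when both coefficients lie in the image of [X0]. *)
- rewrite (B1K_coord _ d0) -!coker_class_eq0.
  by split=> [[-> ->]|[-> ->]].
exists phi; split=> // a b Z /(log_coord_eq X0_R_basis) Zab.
by rewrite /H1K_class phiE Zab.
Qed.

End PrenormalForms.

Theorem mainTheorem3 (R : realType) (p1 p2 : nat) (delta0 : int)
    (h0 : fps2 R[i]) (X0 X : vfield R[i])
    (p1_gt0 : (0 < p1)%N) (p2_gt0 : (0 < p2)%N) (p12 : coprime p1 p2)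
    (* S is the germ of curve with reduced equation h0 = 0 *)
    (h0_reduced : reduced_equation h0)
    (* X0 is a quasi-homogeneous vector field leaving S invariant *)
    (X0_conv : vconvergent X0)
    (X0_qh : quasi_homogeneous p1 p2 delta0 X0)
    (X0_log : X0 \in log_pred h0)
    (X0_basis : log_basis h0 X0 (radial R[i] p1 p2))
    (* X is a perturbation of X0 leaving S invariant *)
    (X_log : X \in log_pred h0)
    (X_pert : forall d : int,
       vcomponent p1 p2 d (X - X0) != 0 -> (delta0 < d)%R) :
  (exists phi : {linear G1K h0 X0 -> Coker X0},
     bijective phi /\
     forall (alpha beta : fps2 R[i]) (Z : log_field h0),
       val Z = alpha *: X0 + beta *: radial R[i] p1 p2 ->
       phi (G1K_class X0 Z) = coker_class X0 beta) /\
  (delta0 = 0 ->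
   exists phi : {linear H1K h0 X0 -> (Coker X0 * Coker X0)%type},
     bijective phi /\
     forall (alpha beta : fps2 R[i]) (Z : log_field h0),
       val Z = alpha *: X0 + beta *: radial R[i] p1 p2 ->
       phi (H1K_class X0 Z) = (coker_class X0 alpha, coker_class X0 beta)).
Proof.
(* Quasi-homogeneity unfolds to the bracket relation between the radial field and [X0], with [d]
   equal to [delta0]. *)
split; first exact: G1K_iso X0_qh X0_basis.
exact: H1K_iso X0_qh X0_basis.
Qed.
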